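(* Let $\xi$, $\Lambda(\cdot)$, $B$, $\zeta$, $H$ and $\mathcal{G}$ satisfy the standing assumptions given in the context, let $G\in\mathcal{G}$, and put $\lambda_t=\mathrm{ess\,inf}\,\Lambda(t)$, $V_t(\lambda)=\mathbf{P}(\Lambda(t)<\lambda)$ and $\eta_t(u)=\xi(\Lambda(t)u)$, $u\in[0,1]$. Suppose that there exist a positive, increasing, continuous function $f(t)$ with $f(t)\to\infty$ as $t\to\infty$ and a non-negative random variable $\Lambda$ such that the distributions of $\Lambda(t)/f(t)$ converge weakly to the distribution of $\Lambda$ as $t\to\infty$. Put $\hat\lambda=\mathrm{ess\,inf}\,\Lambda$. Assume that $B(t)$ is a regularly varying at infinity function, $\hat\lambda=0$, and $\lambda_t/f(t)\to\hat\lambda=0$ as $t\to\infty$. Assume that there is $\lambda'>0$ such that for all $t>0$ the functions $F_t(\lambda)=V_t(\lambda f(t))$ and $F(\lambda)=\mathbf{P}(\Lambda<\lambda)$ are continuous for $\lambda\le\lambda'$ and positive for $\lambda\in(\lambda_t/f(t),\lambda']$ and $\lambda\in(0,\lambda']$, respectively. Let $y_t$ be a positive function with $y_t\to\infty$, $y_t=o(B(f(t)))$ and $f(t)\zeta(y_t)\to\infty$ as $t\to\infty$. Let $\varepsilon_t$ denote the solution of the equation $$\frac{-\log F_t(\varepsilon_t)}{\varepsilon_t}=f(t)H(G)\zeta(y_t).$$ Suppose that $\varepsilon_tf(t)$ is equivalent (as $t\to\infty$) to a continuous, strictly increasing function. Assume that $y_t=o(B(\varepsilon_tf(t)))$, $\lambda_t=o(\varepsilon_tf(t))$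 and that for every $\tau>0$ $$\log F_t(\tau\varepsilon_t)\sim\log F_t(\varepsilon_t)\quad\text{as }t\to\infty.$$ Then $$\log\mathbf{P}\left(\eta_t(\cdot)\in Gy_t\right)=\log F_t(\varepsilon_t)(1+o(1))=-\varepsilon_tf(t)H(G)\zeta(y_t)(1+o(1))\quad\text{as }t\to\infty,$$ and moreover $\varepsilon_t\to0$ and $F_t(\varepsilon_t)\to0$ as $t\to\infty$.
   Context: Standing assumptions. $\xi(t)$ and $\Lambda(t)$, $t\ge 0$, are independent real-valued stochastic processes on the same probability space. With probability 1, $\Lambda(t)$ has continuous trajectories, $\Lambda(t)\ge 0$ and $\Lambda(0)=0$; with probability 1, the trajectories of $\xi(t)$ are right continuous and $\xi(0)=0$. For $t\ge 0$ put $\xi_t(u)=\xi(tu)$, $u\in[0,1]$; trajectories of $\xi_t$ and of $\eta_t$ are regarded as elements of the Skorohod space $D[0,1]$. $\mathcal{G}$ is the collection of all sets $G=\{g\in D[0,1]: g(0)=0,\ -g_1(u)\le g(u)\le g_2(u)\text{ for all }u\in[0,1]\}$, where $g_1,g_2$ are positive, continuous, non-decreasing functions on $[0,1]$ (so $g_i(0)>0$). For real $a$, $aG=\{ag: g\in G\}$, and $Gy_t$ means $y_tG$. $B(t)$ and $\zeta(t)$, $t>0$, are positive functions and $H(G)$, $G\in\mathcal{G}$, is a positive functional such that $B(t)\to\infty$ and $\zeta(t)\to0$ as $t\to\infty$, $\limsup_{t\to\infty}B(ct)/B(t)<\infty$ for all $c>0$, and for every $G\in\mathcal{G}$ the relation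 $$\log\mathbf{P}\left(\xi_t(\cdot)\in Gy_t\right)=-tH(G)\zeta(y_t)(1+o(1))\quad\text{as }t\to\infty$$ holds for every positive function $y_t$ with $y_t\to\infty$, $y_t=o(B(t))$ and $t\zeta(y_t)\to\infty$ as $t\to\infty$. Notation: $a_t\sim b_t$ (equivalence) means $a_t/b_t\to1$ as $t\to\infty$; $\mathrm{ess\,inf}$ denotes the essential infimum of a random variable. The random variable $\Lambda$ (without argument) is the weak limit and is distinct from the process $\Lambda(t)$. *)

(* Defs.v *)
From HB Require Import structures.
From mathcomp Require Import all_boot all_order all_algebra.
From mathcomp Require Import all_classical all_reals all_analysis ess_sup_inf.

Set Implicit Arguments.
Unset Strict Implicit.
Unset Printing Implicit Defensive.

Import Order.TTheory GRing.Theory Num.Theory.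
Import numFieldNormedType.Exports.

Local Open Scope classical_set_scope.
Local Open Scope ring_scope.

Section Paths.
Context {R : realType}.
Implicit Types (g : R -> R) (G : set (R -> R)).

(* An element of D[0,1] is represented by any function R -> R having its values
   on [0,1]; the values outside [0,1] are irrelevant in every definition. *)
Definition D01 : set (R -> R) := [set g : R -> R |
  (forall u : R, 0 <= u < 1 -> g v @[v --> u^'+] --> g u) /\
  (forall u : R, 0 < u <= 1 -> exists l : R, g v @[v --> u^'-] --> l)].

Definition tube (g1 g2 : R -> R) : set (R -> R) := [set g : R -> R |
  [/\ D01 g, g 0 = 0 & forall u : R, 0 <= u <= 1 -> - g1 u <= g u <= g2 u]].

Definition boundary_fun g :=
  [/\ forall u : R, 0 <= u <= 1 -> 0 < g u,
      {within `[0, 1], continuous g} &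
      {in `[0, 1] &, {homo g : u v / u <= v}}].

Definition tubes : set (set (R -> R)) := [set G |
  exists g1 g2, [/\ boundary_fun g1, boundary_fun g2 & G = tube g1 g2]].

Definition scale_set (a : R) G : set (R -> R) :=
  [set (fun u : R => a * g u) | g in G].

End Paths.

Section Asymptotics.
Context {R : realType}.
Implicit Types a b B : R -> R.

Definition asymp_equiv a b := a t / b t @[t --> +oo] --> (1 : R).

(* Used only for b that is eventually nonzero. *)
Definition little_o a b := a t / b t @[t --> +oo] --> (0 : R).

(* a_t = b_t (1 + o(1)) as t -> +oo *)
Definition eq_1po1 a b := exists2 r : R -> R,
  r t @[t --> +oo] --> (0 : R) & \forall t \near +oo, a t = b t * (1 + r t).

Definition regularly_varying B := exists A rho : R,
  [/\ 0 < A, measurable_fun `[A, +oo[ B, forall t : R, A <= t -> 0 < B t &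
      forall c : R, 0 < c -> B (c * t) / B t @[t --> +oo] --> c `^ rho].

End Asymptotics.

Section Probability.
Context {R : realType} {d : measure_display} {T : measurableType d}.
Variable P : probability T R.

(* Path events are defined through trajectories that are regular only almost
   surely, so they are measurable only up to a null set. The outer measure of P
   is P on measurable sets, and the completion of P on such events. *)
Definition Pr (A : set T) : R := fine (mu_ext P A).

Definition sigma_process (X : R -> T -> R) : set_system T :=
  <<s \bigcup_(t in [set t : R | 0 <= t])
        preimage_set_system setT (X t) (@measurable _ R) >>.

Definition independent_processes (X Y : R -> T -> R) :=
  forall A B, sigma_process X A -> sigma_process Y B ->
    P (A `&` B) = (P A * P B)%E.

Definition ess_inf_rv (X : T -> R) : R := fine (ess_inf P (EFin \o X)).

(* the (left-continuous) distribution function x |-> P(X < x) *)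
Definition df (X : T -> R) (x : R) : R := fine (P [set w | X w < x]).

End Probability.

(* The limit Z may live on a different probability space. *)
Definition weak_cvg {R : realType}
    {d : measure_display} {T : measurableType d} (P : probability T R)
    {d' : measure_display} {T' : measurableType d'} (P' : probability T' R)
    (X : R -> T -> R) (Z : T' -> R) :=
  forall phi : R -> R, continuous phi -> (exists M : R, forall x : R, `|phi x| <= M) ->
    \int[P]_w phi (X t w) @[t --> +oo] --> \int[P']_w phi (Z w).

(* Main.v *)
Require Import Defs.
From HB Require Import structures.
From mathcomp Require Import all_boot all_order all_algebra.
From mathcomp Require Import all_classical all_reals all_analysis ess_sup_inf.
From mathcomp Require Import measurable_realfun.
From mathcomp Require Import ring lra.

Set Implicit Arguments.
Unset Strict Implicit.
Unset Printing Implicit Defensive.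

Import Order.TTheory GRing.Theory Num.Theory.
Import numFieldNormedType.Exports.

Local Open Scope classical_set_scope.
Local Open Scope ring_scope.

(* Stretching time only makes it harder to stay in the tube y G, because g1 and
   g2 are non-decreasing. Hence (with independence on the left), for every b > 0,
     P(Lambda(t) < b) P(xi_b in y G) <= P(eta_t in y G)
                                     <= P(Lambda(t) < b) + P(xi_b in y G).
   With L_t = - log F_t(eps_t), the choice of eps_t makes both terms on the
   right equal to exp(- L_t (1 + o(1))) when b = eps_t f(t), whereas on the left
   b = tau eps_t f(t) gives exp(- (1 + tau) L_t (1 + o(1))), and tau is
   arbitrarily small. Weak convergence to a law without atom at 0 and with
   essential infimum 0 forces eps_t -> 0 and F_t(eps_t) -> 0, so L_t -> +oo. *)

(** * Outer probability and almost sure inclusion of events *)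

Section OuterProbability.
Context {R : realType} {d : measure_display} {T : measurableType d}.
Variable P : probability T R.
Implicit Types A B : set T.

Lemma measurable_sublevel (X : T -> R) (c : R) :
  measurable_fun setT X -> measurable [set w | X w < c].
Proof.
move=> mX; rewrite -[X in measurable X]setTI.
have -> : [set w | X w < c] = X @^-1` `]-oo, c[%classic.
  by apply/seteqP; split => w /=; rewrite in_itv.
exact: mX.
Qed.

Lemma mu_ext_fin_num A : mu_ext P A \is a fin_num.
Proof.
rewrite ge0_fin_numE ?mu_ext_ge0//.
apply: (@le_lt_trans _ _ (mu_ext P setT)); first exact: le_mu_ext.
by rewrite measurable_mu_extE//= probability_setT ltry.
Qed.

Lemma Pr_measurable A : measurable A -> Pr P A = fine (P A).
Proof. by move=> mA; rewrite /Pr measurable_mu_extE. Qed.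

Lemma le_Pr A B : A `<=` B -> Pr P A <= Pr P B.
Proof. by move=> AB; rewrite fine_le ?mu_ext_fin_num// le_mu_ext. Qed.

Lemma Pr_le1 A : Pr P A <= 1.
Proof.
have := @le_Pr A setT (@subsetT _ _).
by rewrite [Pr P setT]Pr_measurable// probability_setT.
Qed.

Lemma Pr_setU A B : Pr P (A `|` B) <= Pr P A + Pr P B.
Proof.
rewrite /Pr -fineD ?mu_ext_fin_num//; apply: fine_le.
- exact: mu_ext_fin_num.
- by rewrite fin_numD !mu_ext_fin_num.
- exact: (outer_measureU2 (mu_ext P)).
Qed.

(** The exceptional points lie in a measurable null set [N], so [A] is contained in [B] union [N],
    and subadditivity of the outer measure absorbs [N]. This also covers events that are measurable
    only up to a null set. *)
Lemma ae_le_Pr A B : {ae P, forall w, A w -> B w} -> Pr P A <= Pr P B.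
Proof.
move=> [N [mN N0 sub]].
have : Pr P A <= Pr P (B `|` N).
  apply: le_Pr => w Aw; have [Bw|nBw] := pselect (B w); first by left.
  by right; apply: sub => /= AB; apply: nBw; exact: AB.
move=> /le_trans; apply; apply: (le_trans (Pr_setU _ _)).
by rewrite (Pr_measurable mN) N0 addr0.
Qed.

Lemma le_df (X : {RV P >-> R}) (x x' : R) : x <= x' -> df P X x <= df P X x'.
Proof.
move=> xx'; rewrite /df -!Pr_measurable; try exact: measurable_sublevel.
by apply: le_Pr => w /= /lt_le_trans; exact.
Qed.

End OuterProbability.

(** * Tubes under a change of time scale, and their countable description *)

Section TubePaths.
Context {R : realType}.
Implicit Types (g x : R -> R).

Lemma scale_tubeP (a : R) g1 g2 x : 0 < a ->
  scale_set a (tube g1 g2) x <->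
  [/\ D01 x, x 0 = 0 &
      forall u, 0 <= u <= 1 -> - (a * g1 u) <= x u <= a * g2 u].
Proof.
move=> a0; split.
- move=> [g [[gr gl] g0 gb] <-]; split; last 2 first.
  + by rewrite g0 mulr0.
  + move=> u u01; have /andP[gu1 gu2] := gb u u01.
    by rewrite -mulrN !ler_pM2l// gu1.
  + split=> u u01; first by apply: cvgMr; exact: gr.
    by have [l gul] := gl u u01; exists (a * l); apply: cvgMr.
- move=> [[xr xl] x0 xb]; exists (fun u => a^-1 * x u); last first.
    by apply/funext => u; rewrite mulrA divff ?mul1r ?gt_eqF.
  split; last 2 first.
  + by rewrite x0 mulr0.
  + move=> u u01; have /andP[xu1 xu2] := xb u u01.
    by rewrite ler_pdivlMl// ler_pdivrMl// mulrN xu1.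
  + split=> u u01; first by apply: cvgMr; exact: xr.
    by have [l xul] := xl u u01; exists (a^-1 * l); apply: cvgMr.
Qed.

(** With v = (s/b)u one has v <= u and x(su) = x(bv), and monotone boundaries make the bounds at v
    at least as strict as those at u. The value s = 0 is allowed since [Lambda t w] may vanish. *)
Lemma scale_tube_time (a : R) g1 g2 x (s b : R) :
  boundary_fun g1 -> boundary_fun g2 -> 0 < a -> 0 <= s <= b -> 0 < b ->
  D01 (fun u => x (s * u)) ->
  scale_set a (tube g1 g2) (fun u => x (b * u)) ->
  scale_set a (tube g1 g2) (fun u => x (s * u)).
Proof.
move=> [_ _ ng1] [_ _ ng2] a0 /andP[s0 sb] b0 Ds /(scale_tubeP _ _ _ a0)[_ x0 xb].
apply/scale_tubeP => //; split => //; first by move: x0; rewrite !mulr0.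
move=> u /andP[u0 u1].
have sb1 : s / b <= 1 by rewrite ler_pdivrMr ?mul1r.
have v0 : 0 <= s / b * u by rewrite mulr_ge0// divr_ge0// ltW.
have vu : s / b * u <= u by rewrite ler_piMl.
have v1 : s / b * u <= 1 by exact: le_trans u1.
have sbE : b * (s / b * u) = s * u by field; rewrite gt_eqF.
have := xb (s / b * u); rewrite v0 v1 sbE => /(_ isT) /andP[x1 x2].
apply/andP; split.
- apply: le_trans x1; rewrite lerN2 ler_pM2l//.
  by apply: ng1; rewrite ?in_itv/= ?v0 ?v1 ?u0.
- apply: (le_trans x2); rewrite ler_pM2l//.
  by apply: ng2; rewrite ?in_itv/= ?v0 ?v1 ?u0.
Qed.

(** Truncation at 1 lets every pair of indices name a rational point of [0,1], so events over the
    grid are plain countable intersections. *)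
Definition grid (n m : nat) : R := Num.min (m%:R / n.+1%:R) 1.

Lemma grid_itv n m : 0 <= grid n m <= 1.
Proof. by rewrite /grid le_min ge_min lexx ler01 divr_ge0//= orbT. Qed.

(** If z(u) < 0, right continuity keeps z negative on some interval (u, u+e), and a fine enough grid
    has a point inside it. *)
Lemma grid_ge0 (z : R -> R) (u : R) : 0 <= u < 1 ->
  z v @[v --> u^'+] --> z u -> (forall n m, 0 <= z (grid n m)) -> 0 <= z u.
Proof.
move=> /andP[u0 u1] zu zg; rewrite leNgt; apply/negP => zu0.
have : \forall v \near u^'+, z v < 0 by exact: cvgr_lt zu _ zu0.
rewrite near_withinE => -[e /= e0 he].
(* A mesh below e makes the grid point land where z < 0; a mesh below 1 - u keeps it under 1, so the
   truncation in [grid] is inactive. *)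
have [n ne] : exists n : nat, n.+1%:R^-1 < Num.min e (1 - u).
  have me0 : 0 < Num.min e (1 - u) by rewrite lt_min e0 subr_gt0.
  exists (Num.truncn (Num.min e (1 - u))^-1).
  by rewrite invf_plt ?posrE// truncnS_gt.
move: ne; rewrite lt_min => /andP[ne nu].
(* The successor makes m/(n+1) the first multiple of the mesh strictly to the right of u, as the
   punctured neighbourhood demands. *)
pose m := (Num.truncn (u * n.+1%:R)).+1.
have /andP[mu1 mu2] : (u * n.+1%:R < m%:R) && (m%:R <= u * n.+1%:R + 1).
  have := truncn_itv (mulr_ge0 u0 (ler0n R n.+1)) => /andP[h1 h2].
  by rewrite h2 /m -natr1 lerD2r.
have n0 : 0 < n.+1%:R :> R by [].
have um : u < m%:R / n.+1%:R by rewrite ltr_pdivlMr.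
have mu : m%:R / n.+1%:R <= u + n.+1%:R^-1.
  by rewrite ler_pdivrMr// mulrDl mulVf ?gt_eqF.
have gE : grid n m = m%:R / n.+1%:R.
  by rewrite /grid min_l// (le_trans mu)// -lerBrDl ltW.
have := zg n m; rewrite gE leNgt => /negP; apply.
move: um mu ne; set q := m%:R / _; set p := _^-1 => um mu ne.
by apply: he => //=; rewrite ltr0_norm; lra.
Qed.

Lemma boundary_fun_right g (u : R) : boundary_fun g -> 0 <= u < 1 ->
  g v @[v --> u^'+] --> g u.
Proof.
move=> [_ /continuous_within_itvP-/(_ ltr01)[gc g0 _] _] /andP[u0 u1].
move: u0; rewrite le_eqVlt => /predU1P[<-//|u0].
by apply: cvg_at_right_filter; apply: gc; rewrite in_itv/= u0.
Qed.

(** Right continuity of the path and of the boundaries extends both inequalities from the grid to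
    every u < 1. The endpoint 1 has no right neighbourhood in [0,1], but it is itself the grid point
    [grid 0 1]. *)
Lemma grid_tube (a : R) g1 g2 x : 0 < a ->
  boundary_fun g1 -> boundary_fun g2 -> D01 x -> x 0 = 0 ->
  (forall n m, - (a * g1 (grid n m)) <= x (grid n m) <= a * g2 (grid n m)) ->
  scale_set a (tube g1 g2) x.
Proof.
move=> a0 bg1 bg2 Dx x0 xb; apply/scale_tubeP => //; split => // u /andP[u0].
rewrite le_eqVlt => /predU1P[->|u1].
  by have := xb 0 1; rewrite /grid divr1 minxx.
have u01 : 0 <= u < 1 by rewrite u0.
have xu : x v @[v --> u^'+] --> x u by exact: Dx.1.
apply/andP; split.
- rewrite -subr_ge0 opprK.
  apply: (@grid_ge0 (fun v => x v + a * g1 v)) => //.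
    by apply: cvgD => //; apply: cvgMr; exact: boundary_fun_right.
  by move=> n m; have /andP[] := xb n m; rewrite -subr_ge0 opprK.
- rewrite -subr_ge0.
  apply: (@grid_ge0 (fun v => a * g2 v - x v)) => //.
    by apply: cvgB => //; apply: cvgMr; exact: boundary_fun_right.
  by move=> n m; have /andP[] := xb n m; rewrite subr_ge0.
Qed.

End TubePaths.

(** * Bounds for the time-changed process by fixed time scales *)

Section TimeChange.
Context {R : realType} {d : measure_display} {T : measurableType d}.
Variables (P : probability T R) (xi Lambda : R -> {RV P >-> R}).
Variables (g1 g2 : R -> R).
Hypotheses (bg1 : boundary_fun g1) (bg2 : boundary_fun g2).
Hypothesis indep : independent_processes P xi Lambda.
Hypothesis Lambda_ge0 :
  {ae P, forall w, forall t : R, 0 <= t -> 0 <= Lambda t w}.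
Hypothesis xi_paths : {ae P, forall w, xi 0 w = 0 /\
  forall t : R, 0 <= t -> D01 (fun u : R => xi (t * u) w)}.

Let stay (s a : R) :=
  [set w | scale_set a (tube g1 g2) (fun u : R => xi (s * u) w)].

(* Since xi is only almost surely regular, [stay s a] need not be an event of
   the process xi; it is replaced by its trace on a countable grid of times. *)
Let grid_stay (s a : R) := \bigcap_n \bigcap_m
  [set w | - (a * g1 (grid n m)) <= xi (s * grid n m) w <= a * g2 (grid n m)].

Let grid_stayE s a : grid_stay s a = \bigcap_n \bigcap_m
  (xi (s * grid n m) @^-1` `[- (a * g1 (grid n m)), a * g2 (grid n m)]%classic).
Proof.
by apply: eq_bigcap => // n _; exact: eq_bigcap.
Qed.

Let sigma_grid_stay s a : 0 <= s -> sigma_process xi (grid_stay s a).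
Proof.
move=> s0; rewrite grid_stayE.
pose C := \bigcup_(t in [set t : R | 0 <= t])
  preimage_set_system setT (xi t) (@measurable _ R).
apply: (@bigcap_measurableType _ (g_sigma_algebraType C)) => n _.
apply: (@bigcap_measurableType _ (g_sigma_algebraType C)) => m _.
apply: sub_sigma_algebra; exists (s * grid n m).
  by rewrite /= mulr_ge0//; have /andP[] := @grid_itv R n m.
by exists `[- (a * g1 (grid n m)), a * g2 (grid n m)]%classic;
  rewrite ?setTI.
Qed.

Let measurable_grid_stay s a : measurable (grid_stay s a).
Proof.
rewrite grid_stayE; apply: bigcap_measurableType => n _.
apply: bigcap_measurableType => m _.
by rewrite -[X in measurable X]setTI; exact: measurable_funP.
Qed.

Let measurable_lt (t b : R) : measurable [set w | Lambda t w < b].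
Proof. exact: measurable_sublevel. Qed.

Let sigma_lt t b : 0 <= t -> sigma_process Lambda [set w | Lambda t w < b].
Proof.
move=> t0; apply: sub_sigma_algebra; exists t => //.
exists `]-oo, b[%classic => //.
by rewrite setTI; apply/seteqP; split => w /=; rewrite in_itv.
Qed.

Let stay_grid s a : 0 < a -> stay s a `<=` grid_stay s a.
Proof.
move=> a0 w /(scale_tubeP _ _ _ a0)[_ _ b] n _ m _ /=.
by apply: b; exact: grid_itv.
Qed.

(** Independence is applied to the grid event, which belongs to [sigma_process xi]. That event
    contains the tube event at scale [b]; conversely, almost surely it puts the path at scale [b] in
    the tube, hence also the path at any smaller scale [Lambda t w]. *)
Lemma Pr_time_change_ge (t b a : R) : 0 <= t -> 0 < b -> 0 < a ->
  df P (Lambda t) b *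
    Pr P [set w | scale_set a (tube g1 g2) (fun u => xi (b * u) w)] <=
  Pr P [set w | scale_set a (tube g1 g2) (fun u => xi (Lambda t w * u) w)].
Proof.
move=> t0 b0 a0; set E := grid_stay b a.
have mL := measurable_lt t b; have mE : measurable E := measurable_grid_stay b a.
set rhs := leRHS.
have : Pr P (E `&` [set w | Lambda t w < b]) <= rhs.
  apply: ae_le_Pr; apply: filterS2 Lambda_ge0 xi_paths => w L0 [x0 xD] [/= Ew Lb].
  have Lt0 := L0 _ t0; apply: (@scale_tube_time _ a _ _ (xi ^~ w) _ b) => //.
  - by rewrite Lt0 ltW.
  - exact: xD.
  - apply: grid_tube => //; first by apply: xD; exact: ltW.
    + by rewrite mulr0.
    + by move=> n m; exact: Ew.
apply: le_trans; rewrite [leRHS]Pr_measurable; last exact: measurableI.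
rewrite indep; [|exact: sigma_grid_stay (ltW b0)|exact: sigma_lt].
rewrite fineM ?fin_num_measure// mulrC.
by rewrite ler_wpM2r ?fine_ge0// -Pr_measurable// le_Pr//; exact: stay_grid.
Qed.

(** Off the event Lambda(t) < b the scale [b] is at most Lambda(t), so the path at scale [b] stays
    in the tube whenever the time-changed one does. *)
Lemma Pr_time_change_le (t b a : R) : 0 < b -> 0 < a ->
  Pr P [set w | scale_set a (tube g1 g2) (fun u => xi (Lambda t w * u) w)] <=
  df P (Lambda t) b +
    Pr P [set w | scale_set a (tube g1 g2) (fun u => xi (b * u) w)].
Proof.
move=> b0 a0; rewrite /df -(Pr_measurable P (measurable_lt t b)).
apply: le_trans (Pr_setU _ _ _).
apply: ae_le_Pr; apply: filterS xi_paths => w [x0 xD] /= ew.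
have [Lb|bL] := ltP (Lambda t w) b; [by left|right].
apply: (@scale_tube_time _ a _ _ (xi ^~ w) _ (Lambda t w)) => //.
- by rewrite bL ltW.
- exact: lt_le_trans bL.
- by apply: xD; exact: ltW.
Qed.

End TimeChange.

(** * Distribution functions under weak convergence *)

Section WeakConvergence.
Context {R : realType}.

(** For a < b, a bounded continuous test function lying between the indicators of x < a and x <
    b. *)
Definition ramp (a b x : R) : R := Num.max 0 (Num.min 1 ((b - x) / (b - a))).

Lemma continuous_ramp (a b : R) : continuous (ramp a b).
Proof.
have rE : ramp a b = cst 0 \max (cst 1 \min (fun x : R => (b - x) / (b - a))) by [].
rewrite rE => x; apply: continuous_max; first exact: cvg_cst.
apply: continuous_min; first exact: cvg_cst.
by apply: cvgMl; apply: cvgB; [exact: cvg_cst|exact: cvg_id].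
Qed.

Lemma ramp_itv (a b x : R) : 0 <= ramp a b x <= 1.
Proof. by rewrite /ramp le_max lexx/= ge_max ler01 ge_min lexx. Qed.

Lemma ramp1 (a b x : R) : a < b -> x <= a -> ramp a b x = 1.
Proof.
move=> ab xa; rewrite /ramp min_l ?max_r// ler_pdivlMr ?subr_gt0// mul1r.
by rewrite lerD2l lerN2.
Qed.

Lemma ramp0 (a b x : R) : a < b -> b <= x -> ramp a b x = 0.
Proof.
move=> ab bx; rewrite /ramp max_l// ge_min; apply/orP; right.
by rewrite ler_pdivrMr ?subr_gt0// mul0r subr_le0.
Qed.

Lemma df_ramp {d} {T : measurableType d} (P : probability T R) (X : T -> R)
    (a b : R) : measurable_fun setT X -> a < b ->
  df P X a <= \int[P]_w ramp a b (X w) <= df P X b.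
Proof.
move=> mX ab.
have mlt c : measurable [set w | X w < c] by exact: measurable_sublevel.
have dfE c : df P X c = \int[P]_w \1_[set w | X w < c] w.
  by rewrite /Rintegral/= integral_indic ?setIT.
have iI c : P.-integrable setT (EFin \o \1_[set w | X w < c]).
  by apply: integrable_indic.
have iR : P.-integrable setT (EFin \o (fun w => ramp a b (X w))).
  apply: measurable_bounded_integrable => //.
  - by apply: (le_lt_trans (probability_le1 P _)) => //; rewrite ltry.
  - apply: measurableT_comp => //.
    exact: continuous_measurable_fun (@continuous_ramp a b).
  - exists 1; split => // M M1 w _ /=.
    have /andP[h0 h1] := ramp_itv a b (X w).
    by rewrite ger0_norm// (le_trans h1) ?ltW.
rewrite !dfE; apply/andP; split; apply: le_Rintegral => // w _;
  rewrite indicE; case: (boolP (w \in _)) => /= wX.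
- by move: wX; rewrite inE/= => wa; rewrite ramp1// ltW.
- by have /andP[] := ramp_itv a b (X w).
- by have /andP[] := ramp_itv a b (X w).
- by rewrite ramp0// leNgt; apply: contra wX => wb; rewrite inE.
Qed.

Context {d : measure_display} {T : measurableType d} (P : probability T R).
Context {d' : measure_display} {T' : measurableType d'} (P' : probability T' R).
Variables (X : R -> T -> R) (Z : T' -> R).
Hypotheses (mX : forall t, measurable_fun setT (X t))
  (mZ : measurable_fun setT Z).
Hypothesis XZ : weak_cvg P P' X Z.

Let ramp_cvg (a b : R) :
  \int[P]_w ramp a b (X t w) @[t --> +oo] --> \int[P']_w ramp a b (Z w).
Proof.
apply: XZ; first exact: continuous_ramp.
exists 1 => x; have /andP[h0 h1] := ramp_itv a b x.
by rewrite ger0_norm.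
Qed.

(** The gap between [a] and [b] leaves room for a ramp, whose expectations converge; the ramp is
    then compared with a distribution function on each side. *)
Lemma weak_cvg_df_ge (a b e : R) : a < b -> 0 < e ->
  \forall t \near +oo, df P' Z a - e <= df P (X t) b.
Proof.
move=> ab e0; have /andP[h1 _] := df_ramp P' mZ ab.
have /cvgrPdist_le/(_ _ e0) := @ramp_cvg a b.
apply: filterS => t; rewrite ler_distlC => /andP[h _].
have /andP[_ h2] := df_ramp P (mX t) ab.
by apply: le_trans h2; apply: le_trans h; rewrite lerD2r.
Qed.

Lemma weak_cvg_df_le (a b e : R) : a < b -> 0 < e ->
  \forall t \near +oo, df P (X t) a <= df P' Z b + e.
Proof.
move=> ab e0; have /andP[_ h1] := df_ramp P' mZ ab.
have /cvgrPdist_le/(_ _ e0) := @ramp_cvg a b.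
apply: filterS => t; rewrite ler_distlC => /andP[_ h].
have /andP[h2 _] := df_ramp P (mX t) ab.
by apply: (le_trans h2); apply: (le_trans h); rewrite lerD2r.
Qed.

End WeakConvergence.

(** * From asymptotics in t to asymptotics along a family of times *)

Section Reparametrization.
Context {R : realType}.

Lemma near_pinftyP (Q : R -> Prop) :
  (\forall s \near +oo, Q s) <-> exists M : R, forall s, M < s -> Q s.
Proof.
split=> [[M [_ MQ]]|[M MQ]]; first by exists M.
by exists M; split => //; exact: num_real.
Qed.

(** With [M n] a threshold for [Q n], let [N s] be the largest index up to the integer part of s
    whose threshold lies below s. Each fixed n eventually qualifies, so [N] tends to infinity. *)
Lemma diagonal_near (Q : nat -> R -> Prop) :
  (forall n, \forall s \near +oo, Q n s) ->
  exists N : R -> nat, (forall n, \forall s \near +oo, (n <= N s)%N) /\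
    \forall s \near +oo, Q (N s) s.
Proof.
move=> nearQ.
have /choice[M MQ] n : exists M : R, forall s, M < s -> Q n s.
  exact/near_pinftyP.
pose N (s : R) := (\max_(i < (Num.truncn s).+1 | (M i < s)%R) i)%N.
exists N; split.
- move=> n; apply/near_pinftyP; exists (Num.max n%:R (M n)) => s.
  rewrite gt_max => /andP[ns Ms].
  have ns' : (n < (Num.truncn s).+1)%N.
    by rewrite ltnS -(@natrK R n) le_truncn// ltW.
  exact: (@leq_bigmax_cond _ _ _ (Ordinal ns')).
(* Beyond [M 0] the index 0 qualifies, so the maximum is attained by a qualifying index rather than
   being the default 0 of an empty maximum. *)
- apply/near_pinftyP; exists (M 0%N) => s Ms; apply: MQ.
  have /(eq_bigmax_cond (fun i : 'I__ => i : nat)) [i Mi NE] :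
      (0 < #|[pred i : 'I_(Num.truncn s).+1 | (M i < s)%R]|)%N.
    by apply/card_gt0P; exists ord0; rewrite inE.
  by have -> : N s = i by exact: NE.
Qed.

(** Diagonalising two conditions that hold eventually for each n gives Y = N + 1 with Y/B <= 1/N and
    s zeta(Y(s)) >= N(s). *)
Lemma slow_function_exists (B zeta : R -> R) :
  (forall t, 0 < t -> 0 < zeta t) -> B t @[t --> +oo] --> +oo ->
  exists Y : R -> R, [/\ forall t, 0 < Y t, Y t @[t --> +oo] --> +oo,
    little_o Y B & t * zeta (Y t) @[t --> +oo] --> +oo].
Proof.
move=> zeta0 /cvgryPge By.
have [n|N [Noo NQ]] := @diagonal_near (fun n s =>
    n%:R <= s * zeta n.+1%:R /\ n%:R * n.+1%:R <= B s).
  near=> s; split; last by near: s; exact: By.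
  by rewrite -ler_pdivrMr ?zeta0//; near: s; exact: nbhs_pinfty_ge.
have NooR (A : R) : \forall s \near +oo, A <= (N s)%:R.
  apply: filterS (Noo (Num.truncn A).+1) => s As.
  by apply: le_trans (_ : (Num.truncn A).+1%:R <= _);
    rewrite ?ler_nat// ltW// truncnS_gt.
exists (fun s => (N s).+1%:R); split => //.
- apply/cvgryPge => A; apply: filterS (NooR A) => s /le_trans; apply.
  by rewrite ler_nat.
- apply/cvgrPdist_le => e e0; near=> s.
  have [_ NB] : (N s)%:R <= s * zeta (N s).+1%:R /\
      (N s)%:R * (N s).+1%:R <= B s by near: s.
  have B0 : 0 < B s by near: s; apply: filterS (By 1) => s; exact: lt_le_trans.
  have eN : 1 <= e * (N s)%:R.
    by rewrite -ler_pdivrMl// mulr1; near: s; exact: NooR.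
  rewrite sub0r normrN ger0_norm ?divr_ge0 ?(ltW B0)// ler_pdivrMr//.
  apply: le_trans (_ : e * ((N s)%:R * (N s).+1%:R) <= _).
    by rewrite mulrA ler_peMl.
  by rewrite ler_pM2l.
- apply/cvgryPge => A; apply: filterS2 (NooR A) NQ => s h1 [h2 _].
  exact: le_trans h2.
Unshelve. all: by end_near. Qed.

(* A family [(a t, y t)] violating the conclusion would do so along a sequence
   [t_n]; interpolating [y_(t_n)] at the times [a_(t_n)] by a slowly growing
   function gives an admissible Y that violates the hypothesis. *)
Lemma reparametrize (B zeta : R -> R) (phi : R -> R -> R) (c : R) : 0 < c ->
  (forall t, 0 < t -> 0 < zeta t) -> B t @[t --> +oo] --> +oo ->
  (forall Y : R -> R, (forall t, 0 < t -> 0 < Y t) ->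
    Y t @[t --> +oo] --> +oo -> little_o Y B ->
    t * zeta (Y t) @[t --> +oo] --> +oo ->
    eq_1po1 (fun t => phi t (Y t)) (fun t => - (t * c * zeta (Y t)))) ->
  forall a y : R -> R, (forall t, 0 < t -> 0 < y t) ->
    a t @[t --> +oo] --> +oo -> y t @[t --> +oo] --> +oo ->
    y t / B (a t) @[t --> +oo] --> 0 ->
    a t * zeta (y t) @[t --> +oo] --> +oo ->
  asymp_equiv (fun t => phi (a t) (y t)) (fun t => - (a t * c * zeta (y t))).
Proof.
move=> c0 zeta0 By phiY a y y0 ay yy yB azy.
apply/cvgrPdist_le => e e0; apply: contrapT => bad.
pose good t := `|1 - phi (a t) (y t) / - (a t * c * zeta (y t))| <= e.
have /choice[tn htn] (n : nat) : exists t : R, n%:R < t /\ ~ good t.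
  apply: contrapT => h; apply: bad; apply/near_pinftyP; exists n%:R => s ns.
  by apply: contrapT => gs; apply: h; exists s.
have tn_near (Q : R -> Prop) : (\forall t \near +oo, Q t) ->
    exists N, forall n, (N <= n)%N -> Q (tn n).
  move=> /near_pinftyP[M MQ]; exists (Num.truncn M).+1 => n Mn; apply: MQ.
  apply: lt_le_trans (truncnS_gt _) _.
  by apply: le_trans (ltW (htn n).1); rewrite ler_nat.
have [Y0 [Y00 Y0y Y0B Y0z]] := slow_function_exists zeta0 By.
(* Several n may share the same time [a (tn n)]; one of them is chosen, and any choice keeps a
   violation at that time. Elsewhere [Y0] fills in. *)
have /choice[Y hY] (s : R) : exists x, (exists2 n, a (tn n) = s & x = y (tn n)) \/
    (~ (exists n, a (tn n) = s) /\ x = Y0 s).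
  have [[n ns]|ns] := pselect (exists n, a (tn n) = s).
    by exists (y (tn n)); left; exists n.
  by exists (Y0 s); right.
(* A property eventual along both ingredients is eventual for [Y]: the finitely many early indices n
   < N only concern times bounded by the sum of [|a (tn n)|]. *)
have Ynear (Q : R -> R -> Prop) : (\forall t \near +oo, Q (a t) (y t)) ->
    (\forall s \near +oo, Q s (Y0 s)) -> \forall s \near +oo, Q s (Y s).
  move=> /tn_near[N NQ] Q0.
  have : \forall s \near +oo, forall n, (n < N)%N -> a (tn n) < s.
    apply/near_pinftyP; exists (\sum_(n < N) `|a (tn n)|) => s hs n nN.
    apply: le_lt_trans hs; apply: le_trans (ler_norm _) _.
    rewrite (bigD1 (Ordinal nN))//= lerDl.
    by apply: sumr_ge0.
  apply: filterS2 Q0 => s Q0 hs.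
  have [[n ns ->]|[_ ->]//] := hY s.
  rewrite -ns; apply: NQ; rewrite leqNgt; apply/negP => /hs.
  by rewrite ns ltxx.
have Y0' t : 0 < t -> 0 < Y t.
  move=> t0; have [[n _ ->]|[_ ->]//] := hY t.
  by apply: y0; apply: le_lt_trans (htn n).1.
have [|||r r0 hr] := phiY Y Y0'.
- apply/cvgryPge => A; apply: (Ynear (fun _ x => A <= x)).
    by move/cvgryPge : yy; exact.
  by move/cvgryPge : Y0y; exact.
- apply/cvgrPdist_le => u u0; apply: (Ynear (fun s x => `|0 - x / B s| <= u)).
    by move/cvgrPdist_le : yB; exact.
  by move/cvgrPdist_le : Y0B; exact.
- apply/cvgryPge => A; apply: (Ynear (fun s x => A <= s * zeta x)).
    by move/cvgryPge : azy; exact.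
  by move/cvgryPge : Y0z; exact.
have goodY : \forall s \near +oo,
    `|1 - phi s (Y s) / - (s * c * zeta (Y s))| <= e.
  near=> s; have s0 : 0 < s by near: s; exact: nbhs_pinfty_gt.
  have -> : phi s (Y s) = - (s * c * zeta (Y s)) * (1 + r s) by near: s.
  rewrite [X in X / _]mulrC mulfK; last first.
    by rewrite oppr_eq0 gt_eqF// !mulr_gt0// zeta0// Y0'.
  rewrite opprD addrA subrr; near: s.
  by move/cvgrPdist_le : r0; exact.
have /near_pinftyP[M MY] := goodY.
have [N] : exists N, forall n, (N <= n)%N -> M < a (tn n).
  by apply: (tn_near (fun t => M < a t)); move/cvgryPgt : ay; exact.
move=> /(_ _ (leqnn N)) /MY; have [[n <- ->]|[[]]] := hY (a (tn N)).
  exact: (htn n).2.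
by exists N.
Unshelve. all: by end_near. Qed.

End Reparametrization.

(** * Logarithmic asymptotics of sums and products *)

Section LogAsymptotics.
Context {R : realType}.
Implicit Types (a b p q L : R -> R).

Lemma asymp_equiv_near a b b' : (\forall t \near +oo, b t = b' t) ->
  asymp_equiv a b -> asymp_equiv a b'.
Proof.
move=> bb'; apply: cvg_trans; apply: near_eq_cvg.
by apply: filterS bb' => t ->.
Qed.

Lemma asymp_equiv_eq_1po1 a b : (\forall t \near +oo, b t != 0) ->
  asymp_equiv a b -> eq_1po1 a b.
Proof.
move=> b0 ab; exists (fun t => a t / b t - 1).
  by rewrite -(subrr (1 : R)); apply: cvgB => //; exact: cvg_cst.
by apply: filterS b0 => t bt; rewrite addrCA subrr addr0 mulrC divfK.
Qed.

Lemma asymp_equiv_bounds a L (e : R) : 0 < e -> L t @[t --> +oo] --> +oo ->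
  asymp_equiv a (fun t => - L t) ->
  \forall t \near +oo, - ((1 + e) * L t) <= a t <= - ((1 - e) * L t).
Proof.
move=> e0 /cvgryPge Ly /cvgrPdist_le/(_ _ e0).
apply: filterS2 (Ly 1) => t L1; have L0 : 0 < L t by exact: lt_le_trans L1.
rewrite ler_distlC invrN mulrN -mulNr ler_pdivlMr// ler_pdivrMr//.
by rewrite lerNl lerNr andbC.
Qed.

Lemma ln_asymp_bounds q L (e : R) : 0 < e < 1 -> L t @[t --> +oo] --> +oo ->
  asymp_equiv (fun t => ln (q t)) (fun t => - L t) ->
  \forall t \near +oo, expR (- ((1 + e) * L t)) <= q t <= expR (- ((1 - e) * L t)).
Proof.
move=> /andP[e0 e1] Ly /(asymp_equiv_bounds e0 Ly).
move/cvgryPge : Ly => /(_ 1).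
apply: filterS2 => t L1 /andP[h1 h2].
(* The real logarithm is 0 at nonpositive arguments, whereas here [ln (q t)] is strictly
   negative. *)
have q0 : 0 < q t.
  rewrite ltNge; apply/negP => /ln0 lnq.
  move: h2; rewrite lnq; apply/negP; rewrite -ltNge oppr_lt0.
  by rewrite mulr_gt0 ?subr_gt0// (lt_le_trans _ L1).
rewrite -ler_ln ?posrE ?expR_gt0// -[X in _ && X]ler_ln ?posrE ?expR_gt0//.
by rewrite !expRK h1 h2.
Qed.

(** The sum of two terms exp(-L(1+o(1))) has the same logarithmic order because ln 2 = o(L); the
    product below costs a factor 1 + tau in the exponent, with tau arbitrary. *)
Lemma ln_sandwich (u F1 p1 L : R -> R) : L t @[t --> +oo] --> +oo ->
  asymp_equiv (fun t => ln (F1 t)) (fun t => - L t) ->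
  asymp_equiv (fun t => ln (p1 t)) (fun t => - L t) ->
  (\forall t \near +oo, u t <= F1 t + p1 t) ->
  (forall tau : R, 0 < tau -> exists F p : R -> R,
    [/\ asymp_equiv (fun t => ln (F t)) (fun t => - L t),
        asymp_equiv (fun t => ln (p t)) (fun t => - (tau * L t)) &
        \forall t \near +oo, F t * p t <= u t]) ->
  asymp_equiv (fun t => ln (u t)) (fun t => - L t).
Proof.
move=> Ly F1L p1L uFp Fpu; apply/cvgrPdist_le => e' e'0.
(* The cap at 1/2 puts e/4 and e/2 in (0,1) and gives (1 + e/4)^2 <= 1 + e, the exponent of the
   lower bound for tau = e/4. *)
pose e := Num.min e' 2^-1.
have e0 : 0 < e by rewrite lt_min e'0 invr_gt0 ltr0n.
have ee' : e <= e' by rewrite ge_min lexx.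
have e12 : e <= 2^-1 by rewrite ge_min lexx orbT.
have e41 : 0 < e / 4 < 1 by apply/andP; split; lra.
have e40 : 0 < e / 4 by case/andP : e41.
have e21 : 0 < e / 2 < 1 by apply/andP; split; lra.
have [F [p [FL pL FpLe]]] := Fpu _ e40.
have eLy : e / 4 * L t @[t --> +oo] --> +oo.
  apply/cvgryPge => A; move/cvgryPge : Ly => /(_ ((e / 4)^-1 * A)).
  by apply: filterS => t; rewrite ler_pdivrMl.
near=> t.
have L0 : 0 < L t by near: t; move/cvgryPgt : Ly; exact.
have Lln : ln 2 <= e / 2 * L t.
  rewrite -ler_pdivrMl ?divr_gt0//; near: t; move/cvgryPge : Ly; exact.
have /andP[lF _] : expR (- ((1 + e / 4) * L t)) <= F t <=
    expR (- ((1 - e / 4) * L t)) by near: t; exact: ln_asymp_bounds.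
have /andP[lp _] : expR (- ((1 + e / 4) * (e / 4 * L t))) <= p t <=
    expR (- ((1 - e / 4) * (e / 4 * L t))).
  by near: t; exact: (ln_asymp_bounds e41 eLy pL).
have /andP[_ uF] : expR (- ((1 + e / 2) * L t)) <= F1 t <=
    expR (- ((1 - e / 2) * L t)) by near: t; exact: ln_asymp_bounds.
have /andP[_ up] : expR (- ((1 + e / 2) * L t)) <= p1 t <=
    expR (- ((1 - e / 2) * L t)) by near: t; exact: ln_asymp_bounds.
have lu : expR (- ((1 + e) * L t)) <= u t.
  apply: le_trans (_ : F t * p t <= _); last by near: t.
  apply: le_trans (ler_pM (expR_ge0 _) (expR_ge0 _) lF lp).
  rewrite -expRD ler_expR.
  have eL0 : 0 <= e * L t by rewrite mulr_ge0// ltW.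
  have := ler_wpM2r eL0 e12; lra.
have u0 : 0 < u t by apply: lt_le_trans lu; exact: expR_gt0.
have uu : u t <= expR (- ((1 - e) * L t)).
  apply: (@le_trans _ _ (F1 t + p1 t)); first by near: t.
  apply: le_trans (lerD uF up) _.
  have twoE : 2 = expR (ln 2) :> R by rewrite lnK ?posrE.
  rewrite -mulr2n -[leLHS]mulr_natl {1}twoE.
  rewrite -expRD ler_expR; lra.
apply: le_trans ee'; rewrite ler_distlC invrN mulrN -mulNr.
rewrite ler_pdivlMr// ler_pdivrMr//.
move: lu uu; rewrite -ler_ln ?posrE ?expR_gt0// expRK => lu.
rewrite -ler_ln ?posrE ?expR_gt0// expRK => uu.
by rewrite lerNr uu lerNl lu.
Unshelve. all: by end_near. Qed.

Lemma limf_esup_fin_bounded (w : R -> R) :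
  (limf_esup (fun t => (w t)%:E) (pinfty_nbhs R) < +oo)%E ->
  exists2 M : R, 0 < M & \forall t \near +oo, w t <= M.
Proof.
rewrite limf_esupE => /ereal_inf_lt[_ [V FV <-]] Vy.
have [M M0 VM] : exists2 M : R, 0 < M & forall t, V t -> w t <= M.
  have VS t : V t -> ((w t)%:E <= ereal_sup [set (w t)%:E | t in V])%E.
    by move=> Vt; apply: ereal_sup_ubound; exists t.
  case E : (ereal_sup _) Vy VS => [r| |]// _ VS.
  - exists (Num.max r 1); first by rewrite lt_max ltr01 orbT.
    by move=> t /VS; rewrite lee_fin le_max => ->.
  - by exists 1 => // t /VS; rewrite leeNy_eq.
by exists M => //; apply: filterS FV.
Qed.

End LogAsymptotics.

(** * Small deviations of the time-changed process *)

Theorem theorem3 (R : realType)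
  (d : measure_display) (Omega : measurableType d) (P : probability Omega R)
  (xi Lambda : R -> {RV P >-> R})
  (indep_xi_Lambda : independent_processes P xi Lambda)
  (Lambda_paths : {ae P, forall w,
     [/\ {within `[0, +oo[, continuous (fun t : R => Lambda t w)},
         forall t : R, 0 <= t -> 0 <= Lambda t w & Lambda 0 w = 0]})
  (xi_paths : {ae P, forall w,
     [/\ forall t : R, 0 <= t -> xi s w @[s --> t^'+] --> xi t w,
         xi 0 w = 0 &
         forall t : R, 0 <= t -> D01 (fun u : R => xi (t * u) w)]})
  (B zeta : R -> R) (H : set (R -> R) -> R)
  (B_gt0 : forall t : R, 0 < t -> 0 < B t)
  (zeta_gt0 : forall t : R, 0 < t -> 0 < zeta t)
  (H_gt0 : forall G, tubes G -> 0 < H G)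
  (B_cvg : B t @[t --> +oo] --> +oo)
  (zeta_cvg : zeta t @[t --> +oo] --> 0)
  (B_limsup : forall c : R, 0 < c ->
     (limf_esup (fun t : R => (B (c * t) / B t)%:E) (pinfty_nbhs R) < +oo)%E)
  (xi_asymp : forall G, tubes G -> forall y : R -> R,
     (forall t : R, 0 < t -> 0 < y t) ->
     y t @[t --> +oo] --> +oo ->
     little_o y B ->
     t * zeta (y t) @[t --> +oo] --> +oo ->
     eq_1po1
       (fun t : R => ln (Pr P [set w | scale_set (y t) G (fun u : R => xi (t * u) w)]))
       (fun t : R => - (t * H G * zeta (y t))))
  (G : set (R -> R)) (G_tube : tubes G)
  (f : R -> R)
  (f_gt0 : forall t : R, 0 < t -> 0 < f t)
  (f_incr : {in `]0, +oo[ &, {homo f : s t / s <= t}})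
  (f_cont : {within `]0, +oo[, continuous f})
  (f_cvg : f t @[t --> +oo] --> +oo)
  (d' : measure_display) (Omega' : measurableType d')
  (P' : probability Omega' R) (LambdaLim : {RV P' >-> R})
  (LambdaLim_ge0 : {ae P', forall w, 0 <= LambdaLim w})
  (Lambda_weak : weak_cvg P P' (fun (t : R) w => Lambda t w / f t) LambdaLim)
  (lambda : R -> R) (lambdaE : forall t : R, lambda t = ess_inf_rv P (Lambda t))
  (V F_ : R -> R -> R)
  (VE : forall t x, V t x = df P (Lambda t) x)
  (F_E : forall t x, F_ t x = V t (x * f t))
  (F : R -> R) (FE : forall x : R, F x = df P' LambdaLim x)
  (B_rv : regularly_varying B)
  (lambdahat0 : ess_inf_rv P' LambdaLim = 0)
  (lambda_cvg : lambda t / f t @[t --> +oo] --> ess_inf_rv P' LambdaLim)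
  (lambda' : R) (lambda'_gt0 : 0 < lambda')
  (F_t_cont : forall t : R, 0 < t -> {within `]-oo, lambda'], continuous (F_ t)})
  (F_t_gt0 : forall t : R, 0 < t ->
     forall x : R, lambda t / f t < x <= lambda' -> 0 < F_ t x)
  (F_cont : {within `]-oo, lambda'], continuous F})
  (F_gt0 : forall x : R, 0 < x <= lambda' -> 0 < F x)
  (y : R -> R)
  (y_gt0 : forall t : R, 0 < t -> 0 < y t)
  (y_cvg : y t @[t --> +oo] --> +oo)
  (y_o : little_o y (B \o f))
  (f_zeta_y : f t * zeta (y t) @[t --> +oo] --> +oo)
  (eps : R -> R)
  (* the positivity of F_t(eps_t) makes the real logarithm meaningful *)
  (eps_sol : \forall t \near +oo, 0 < F_ t (eps t) /\
     - ln (F_ t (eps t)) / eps t = f t * H G * zeta (y t))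
  (h : R -> R)
  (h_cont : {within `]0, +oo[, continuous h})
  (h_incr : {in `]0, +oo[ &, {homo h : s t / s < t}})
  (eps_h : asymp_equiv (fun t : R => eps t * f t) h)
  (y_o_eps : little_o y (fun t : R => B (eps t * f t)))
  (lambda_o : little_o lambda (fun t : R => eps t * f t))
  (log_F : forall tau : R, 0 < tau ->
     asymp_equiv (fun t : R => ln (F_ t (tau * eps t)))
                 (fun t : R => ln (F_ t (eps t)))) :
  let logP (t : R) :=
    ln (Pr P [set w | scale_set (y t) G (fun u : R => xi (Lambda t w * u) w)]) in
  [/\ eq_1po1 logP (fun t : R => ln (F_ t (eps t))),
      eq_1po1 logP (fun t : R => - (eps t * f t * H G * zeta (y t))),
      eps t @[t --> +oo] --> 0 &
      F_ t (eps t) @[t --> +oo] --> 0].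
Proof.
have [g1 [g2 [bg1 bg2 GE]]] := G_tube.
have HG0 : 0 < H G by exact: H_gt0.
pose a t := eps t * f t.
pose L t := - ln (F_ t (eps t)).
have F_dfE t x : F_ t x = df P (Lambda t) (x * f t) by rewrite F_E VE.
have F_dfX t x : 0 < t -> F_ t x = df P (fun w => Lambda t w / f t) x.
  move=> t0; rewrite F_dfE /df; congr (fine (P _)).
  by apply/seteqP; split => w /=; rewrite ltr_pdivrMr ?f_gt0.
have F_le t x x' : 0 < t -> x <= x' -> F_ t x <= F_ t x'.
  by move=> t0 xx'; rewrite !F_dfE le_df// ler_pM2r ?f_gt0.
have mX t : measurable_fun setT (fun w => Lambda t w / f t).
  by apply: measurable_funM => //; exact: measurable_cst.
have Fge x x' e : x < x' -> 0 < e -> \forall t \near +oo, F x - e <= F_ t x'.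
  move=> xx' e0.
  have hw :=
    weak_cvg_df_ge mX (measurable_funPT LambdaLim) Lambda_weak xx' e0.
  near=> t; rewrite FE F_dfX; last by near: t; exact: nbhs_pinfty_gt.
  by near: t.
have Fle x x' e : x < x' -> 0 < e -> \forall t \near +oo, F_ t x <= F x' + e.
  move=> xx' e0.
  have hw :=
    weak_cvg_df_le mX (measurable_funPT LambdaLim) Lambda_weak xx' e0.
  near=> t; rewrite FE F_dfX; last by near: t; exact: nbhs_pinfty_gt.
  by near: t.
have F0 : F 0 = 0.
  rewrite FE; apply/eqP; rewrite eq_le; apply/andP; split; last first.
    by rewrite fine_ge0.
  rewrite /df -Pr_measurable; last exact: measurable_sublevel.
  apply: le_trans (_ : Pr P' set0 <= _).
    apply: ae_le_Pr; apply: filterS LambdaLim_ge0 => w h0 /=.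
    by rewrite ltNge h0.
  by rewrite Pr_measurable// measure0.
(* The numerator [- ln (F_ t (eps t))] is nonnegative as F_t <= 1, and the quotient is positive,
   which fixes the sign of [eps t]. *)
have eps_gt0 : \forall t \near +oo, 0 < eps t.
  near=> t; have t0 : 0 < t by near: t; exact: nbhs_pinfty_gt.
  have [Ft0 Ft] : 0 < F_ t (eps t) /\
     - ln (F_ t (eps t)) / eps t = f t * H G * zeta (y t) by near: t.
  have : 0 < - ln (F_ t (eps t)) / eps t.
    by rewrite Ft !mulr_gt0 ?f_gt0 ?zeta_gt0 ?y_gt0.
  have lF : 0 <= - ln (F_ t (eps t)).
    rewrite oppr_ge0 ln_le0// F_dfE /df -Pr_measurable ?Pr_le1//.
    exact: measurable_sublevel.
  rewrite !ltNge => /negP nh; apply/negP => e0; apply: nh.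
  by rewrite mulr_ge0_le0// invr_le0.
have LE : \forall t \near +oo, L t = a t * H G * zeta (y t).
  apply: filterS2 eps_sol eps_gt0 => t [_ hE] e0.
  by rewrite /L /a -[LHS](@divfK _ (eps t)) ?gt_eqF// hE; ring.
(* If [eps t] exceeded e, then F_t(eps_t) would be at least F(dl/2)/2 > 0 and [L t] would be
   bounded, although [L t] is at least dl H(G) f(t) zeta(y_t), which is unbounded. Taking dl <=
   lambda' ensures F(dl/2) > 0. *)
have eps_cvg : eps t @[t --> +oo] --> 0.
  apply/cvgrPdist_le => e e0.
  pose dl := Num.min e lambda'.
  have dl0 : 0 < dl by rewrite lt_min e0.
  have dl2 : dl / 2 < dl by rewrite ltr_pdivrMr// ltr_pMr// ltr1n.
  have Fd0 : 0 < F (dl / 2).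
    apply: F_gt0; rewrite divr_gt0//= (le_trans (ltW dl2))//.
    by rewrite ge_min lexx orbT.
  near=> t; have t0 : 0 < t by near: t; exact: nbhs_pinfty_gt.
  have et0 : 0 < eps t by near: t.
  rewrite sub0r normrN gtr0_norm// leNgt; apply/negP => et.
  have dle : dl <= eps t by rewrite (le_trans _ (ltW et))// ge_min lexx.
  have hF : F (dl / 2) / 2 <= F_ t (eps t).
    apply: le_trans (F_le _ _ _ t0 dle).
    have -> : F (dl / 2) / 2 = F (dl / 2) - F (dl / 2) / 2 by field.
    by near: t; apply: Fge => //; rewrite divr_gt0.
  have hL : - ln (F (dl / 2) / 2) < L t.
    apply: lt_le_trans (_ : dl * H G * (f t * zeta (y t)) <= _).
      rewrite -ltr_pdivrMl ?mulr_gt0//; near: t.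
      by move/cvgryPgt : f_zeta_y; exact.
    have -> : L t = eps t * H G * (f t * zeta (y t)).
      have -> : L t = a t * H G * zeta (y t) by near: t.
      by rewrite /a; ring.
    rewrite ler_pM2r; last by rewrite mulr_gt0 ?f_gt0 ?zeta_gt0 ?y_gt0.
    by rewrite ler_pM2r.
  move: hL; rewrite /L ltrN2 ltNge ler_ln ?hF ?posrE//.
    by rewrite divr_gt0.
  by apply: lt_le_trans hF; rewrite divr_gt0.
(* F is continuous at 0 with F(0) = 0, so some F(dl) is small; eventually eps_t <= dl/2, and weak
   convergence bounds F_t(dl/2) by F(dl) plus a small error. *)
have F_cvg0 : F_ t (eps t) @[t --> +oo] --> 0.
  apply/cvgrPdist_le => e e0.
  have [dl dl0 Fdl] : exists2 dl, 0 < dl & F dl < e / 2.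
    have [Fc _] := (continuous_within_itvNycP _ _).1 F_cont.
    have {}Fc : F x @[x --> 0^'+] --> F 0.
      by apply: cvg_at_right_filter; apply: Fc; rewrite in_itv.
    have : \forall x \near 0^'+, F x < e / 2.
      by apply: (cvgr_lt _ Fc); rewrite F0 divr_gt0.
    move=> hF; have : \forall x \near 0^'+, 0 < x /\ F x < e / 2.
      by near=> x; split; [near: x; exact: nbhs_right_gt|near: x].
    by move=> /filter_ex[x [x0 Fx]]; exists x.
  near=> t; have t0 : 0 < t by near: t; exact: nbhs_pinfty_gt.
  have Ft0 : 0 < F_ t (eps t).
    by near: t; apply: filterS eps_sol => t [].
  rewrite sub0r normrN gtr0_norm//.
  apply: (@le_trans _ _ (F_ t (dl / 2))).
    apply: F_le => //; apply: le_trans (ler_norm _) _.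
    rewrite -normrN -sub0r; near: t.
    by move/cvgrPdist_le : eps_cvg; apply; rewrite divr_gt0.
  apply: (@le_trans _ _ (F dl + e / 2)); last first.
    by rewrite [leRHS](splitr e) lerD2r ltW.
  near: t; apply: Fle; rewrite ?divr_gt0//.
  by rewrite ltr_pdivrMr// ltr_pMr// ltr1n.
have Ly : L t @[t --> +oo] --> +oo.
  apply/cvgryPge => A; near=> t.
  have Ft0 : 0 < F_ t (eps t).
    by near: t; apply: filterS eps_sol => t [].
  rewrite /L lerNr -(expRK (- A)) ler_ln ?posrE ?expR_gt0//.
  apply: le_trans (ler_norm _) _; rewrite -normrN -sub0r; near: t.
  by move/cvgrPdist_le : F_cvg0; apply; exact: expR_gt0.
have azy : a t * zeta (y t) @[t --> +oo] --> +oo.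
  apply/cvgryPge => A; near=> t; rewrite -(@ler_pM2r _ (H G))//.
  apply: (@le_trans _ _ (L t)); first by near: t; move/cvgryPge : Ly; exact.
  have -> : L t = a t * H G * zeta (y t) by near: t.
  by rewrite mulrAC.
have zy1 : \forall t \near +oo, zeta (y t) <= 1.
  have /cvgrPdist_le/(_ 1 ltr01) : zeta (y t) @[t --> +oo] --> 0.
    by apply: cvg_comp zeta_cvg.
  by apply: filterS => t; rewrite sub0r normrN; apply: le_trans; exact: ler_norm.
(* Since zeta(y_t) <= 1 eventually, [a t] dominates [a t * zeta (y t)], which tends to infinity. *)
have ay : a t @[t --> +oo] --> +oo.
  apply/cvgryPge => A; near=> t.
  have t0 : 0 < t by near: t; exact: nbhs_pinfty_gt.
  have a0 : 0 < a t by rewrite mulr_gt0 ?f_gt0//; near: t.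
  apply: (@le_trans _ _ (a t * zeta (y t))).
    by near: t; move/cvgryPge : azy; exact.
  by rewrite ler_piMr ?(ltW a0)//; near: t.
pose stay s v := Pr P [set w | scale_set v G (fun u : R => xi (s * u) w)].
have stayE tau : 0 < tau -> asymp_equiv (fun t => ln (stay (tau * a t) (y t)))
    (fun t => - (tau * L t)).
  move=> tau0.
  have tay : tau * a t @[t --> +oo] --> +oo.
    apply/cvgryPge => A; move/cvgryPge : ay => /(_ (tau^-1 * A)).
    by apply: filterS => t; rewrite ler_pdivrMl.
  have tauV0 : 0 < tau^-1 by rewrite invr_gt0.
  (* The ratio B(a_t)/B(tau a_t) is eventually bounded, which transfers y_t = o(B(a_t)) to the scale
     tau a_t. *)
  have [M M0 BM] := limf_esup_fin_bounded (B_limsup _ tauV0).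
  have yBt : y t / B (tau * a t) @[t --> +oo] --> 0.
    apply/cvgrPdist_le => e e0; near=> t.
    have t0 : 0 < t by near: t; exact: nbhs_pinfty_gt.
    have a0 : 0 < a t by rewrite mulr_gt0 ?f_gt0//; near: t.
    have Bt0 : 0 < B (tau * a t) by apply: B_gt0; exact: mulr_gt0.
    have yt0 := y_gt0 _ t0.
    have hB : B (tau^-1 * (tau * a t)) / B (tau * a t) <= M.
      by near: t; exact: tay BM.
    rewrite mulKf ?gt_eqF// ler_pdivrMr// in hB.
    have hy : y t / B (a t) <= e / M.
      apply: le_trans (ler_norm _) _; rewrite -normrN -sub0r; near: t.
      by move/cvgrPdist_le : y_o_eps; apply; exact: divr_gt0.
    rewrite sub0r normrN gtr0_norm ?divr_gt0// ler_pdivrMr//.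
    rewrite (ler_pdivrMr _ _ (B_gt0 _ a0)) in hy; apply: (le_trans hy).
    by rewrite mulrAC ler_pdivrMr// -mulrA ler_pM2l// mulrC.
  have taz : tau * a t * zeta (y t) @[t --> +oo] --> +oo.
    apply/cvgryPge => A; move/cvgryPge : azy => /(_ (tau^-1 * A)).
    apply: filterS => t; rewrite ler_pdivrMl// => /le_trans; apply.
    by rewrite -[leRHS]mulrA.
  have := @reparametrize _ B zeta (fun s v => ln (stay s v)) (H G) HG0 zeta_gt0
    B_cvg (xi_asymp _ G_tube) (fun t => tau * a t) y y_gt0 tay y_cvg yBt taz.
  apply: asymp_equiv_near; apply: filterS LE => t ->.
  by rewrite !mulrA.
have L_ge0 : {ae P, forall w, forall t : R, 0 <= t -> 0 <= Lambda t w}.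
  by apply: filterS Lambda_paths => w [].
have xi_D01 : {ae P, forall w, xi 0 w = 0 /\
    forall t : R, 0 <= t -> D01 (fun u : R => xi (t * u) w)}.
  by apply: filterS xi_paths => w [].
have LE' t : ln (F_ t (eps t)) = - L t by rewrite /L opprK.
have lnFE tau : 0 < tau ->
    asymp_equiv (fun t => ln (F_ t (tau * eps t))) (fun t => - L t).
  move=> tau0; apply: asymp_equiv_near (log_F _ tau0).
  by near=> t.
move=> logP.
(* The scale a_t itself serves for the upper bound, the scales tau a_t for the lower one. *)
have main : asymp_equiv logP (fun t => - L t).
  apply: (@ln_sandwich _ _ (fun t => F_ t (1 * eps t))
    (fun t => stay (1 * a t) (y t)) L Ly).
  - exact: lnFE.
  - by apply: asymp_equiv_near (stayE _ ltr01); near=> t; rewrite mul1r.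
  - near=> t; have t0 : 0 < t by near: t; exact: nbhs_pinfty_gt.
    have a0 : 0 < a t by rewrite mulr_gt0 ?f_gt0//; near: t.
    rewrite !mul1r F_dfE /stay GE.
    exact: (Pr_time_change_le Lambda bg1 bg2 xi_D01 t a0 (y_gt0 _ t0)).
  - move=> tau tau0; exists (fun t => F_ t (tau * eps t)).
    exists (fun t => stay (tau * a t) (y t)); split.
    + exact: lnFE.
    + exact: stayE.
    + near=> t; have t0 : 0 < t by near: t; exact: nbhs_pinfty_gt.
      have a0 : 0 < a t by rewrite mulr_gt0 ?f_gt0//; near: t.
      rewrite F_dfE -mulrA /stay GE.
      exact: (Pr_time_change_ge bg1 bg2 indep_xi_Lambda L_ge0 xi_D01 (ltW t0)
        (mulr_gt0 tau0 a0) (y_gt0 _ t0)).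
have L0 : \forall t \near +oo, - L t != 0.
  move/cvgryPgt : Ly => /(_ 0); apply: filterS => t Lt.
  by rewrite oppr_eq0 gt_eqF.
split=> //.
- apply: asymp_equiv_eq_1po1.
    by apply: filterS L0 => t; rewrite LE'.
  by apply: asymp_equiv_near main; near=> t.
- apply: asymp_equiv_eq_1po1.
    by apply: filterS2 L0 LE => t + <-.
  by apply: asymp_equiv_near main; apply: filterS LE => t ->.
Unshelve. all: by end_near. Qed.
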